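(* Let $V\subseteq A$ be an $F$-vector subspace and fix $r\le n$. The following two conditions are equivalent: (1* ) $\rho_k(a_1,\dots,a_k)=0$ for all $1\le k\le r$ and every $a_1,\dots,a_k\in V$; (2* ) $\mathrm{tr}(a_1,\dots,a_k)=0$ for all $1\le k\le r$ and every $a_1,\dots,a_k\in V$.
   Context: $F$ is a field of arbitrary characteristic, and $A$ is an $F$-algebra contained in the $n\times n$ matrices over some field extension of $F$, such that the characteristic coefficients $\rho_i$ take values in $F$ on $A$. Here $\rho_i:A\to F$ are the polynomial functions such that $(-1)^i\rho_i(a)$ is the coefficient of $t^{n-i}$ in the characteristic (Cayley–Hamilton) polynomial of $a$. For $k\le r$, $$\mathrm{tr}(a_1,\dots,a_k)=\sum_{\eta}\mathrm{tr}(a_1a_{\eta(2)}\cdots a_{\eta(k)}),$$ the sum over all permutations $\eta$ of $\{2,\dots,k\}$ (a sum of $(k-1)!$ traces). Also $\rho_k(a_1,\dots,a_k)\in F$ denotes the coefficient of $t_1\cdots t_k$ in $\rho_k(a_1t_1+\cdots+a_kt_k)$, the characteristic coefficient being taken in $F[t_1,\dots,t_r]\otimes_F A$ with commuting indeterminates $t_i$. *)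

(* Defs.v *)
From HB Require Import structures.
From mathcomp Require Import all_boot all_order all_fingroup all_algebra.
From mathcomp Require Import mpoly.

Set Implicit Arguments.
Unset Strict Implicit.
Unset Printing Implicit Defensive.

Import GRing.Theory.
Local Open Scope ring_scope.

(* A field extension K / F, of possibly infinite degree, is given by a ring
   morphism iota : F -> K; F acts on matrices over K through iota.  Subsets
   are Prop-valued predicates. *)

Record F_subspace (F K : fieldType) (iota : {rmorphism F -> K}) (n : nat)
    (V : 'M[K]_n -> Prop) : Prop := FSubspace {
  F_subspace0 : V 0;
  F_subspaceD : forall a b, V a -> V b -> V (a + b);
  F_subspaceZ : forall (c : F) a, V a -> V (iota c *: a)
}.

(* The identity matrix is not required to belong to A. *)
Record F_subalgebra (F K : fieldType) (iota : {rmorphism F -> K}) (n : nat)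
    (A : 'M[K]_n -> Prop) : Prop := FSubalgebra {
  F_subalgebra_subspace : F_subspace iota A;
  F_subalgebraM : forall a b, A a -> A b -> A (a *m b)
}.

(* Meaningful for i <= n only, because of the truncated subtraction. *)
Definition rho (R : comNzRingType) (n i : nat) (a : 'M[R]_n) : R :=
  (-1) ^+ i * (char_poly a)`_(n - i).

Definition rho_F_valued (F K : fieldType) (iota : {rmorphism F -> K}) (n : nat)
    (A : 'M[K]_n -> Prop) : Prop :=
  forall (a : 'M[K]_n) (i : nat), A a -> (i <= n)%N ->
    exists c : F, rho i a = iota c.

(* F[t_1, .., t_k] (x)_F A is realised inside the n x n matrices over
   K[t_1, .., t_k]. *)
Definition generic_comb (K : fieldType) (n k : nat) (a : 'I_k -> 'M[K]_n) :
    'M[{mpoly K[k]}]_n :=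
  \sum_(i < k) 'X_i *: map_mx (@mpolyC k K) (a i).

Definition rho_polar (K : fieldType) (n k : nat) (a : 'I_k -> 'M[K]_n) : K :=
  (rho k (generic_comb a))@_[multinom 1%N | i < k].

(* With indices shifted to 0, .., k-1, the permutations of {2, .., k} are those
   of 'I_k whose support avoids 0. *)
Definition tr_polar (K : fieldType) (n k : nat) (a : 'I_k -> 'M[K]_n) : K :=
  \sum_(eta : 'S_k | perm_on [set i : 'I_k | (0 < i)%N] eta)
    \tr (\prod_(i < k) a (eta i)).

(* Main.v *)
Require Import Defs.
From HB Require Import structures.
From mathcomp Require Import all_boot all_order all_fingroup all_algebra.
From mathcomp Require Import mpoly.

Set Implicit Arguments.
Unset Strict Implicit.
Unset Printing Implicit Defensive.

Import GRing.Theory.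
Local Open Scope ring_scope.

(** Write B = t_0 a_0 + ... + t_k a_k for the generic combination and e_i for
    [rho i B], the i-th elementary symmetric function of the eigenvalues of B.
    Newton's identities relate the e_i to the traces of the powers of B, but
    with a factor i in front of e_i, which may be zero in positive
    characteristic.  Their derivative in t_0 has no such factor:
      d e_(k+1) / d t_0 = \sum_(j <= k) (-1)^j e_(k-j) tr (a_0 B^j),
    which is [leibniz_rho].  It follows from Jacobi's formula
    d det M = tr (adj M * dM) and from the expression of the adjugate of X - B
    as a polynomial in B.

    Take the coefficient of t_1 ... t_k.  On the left this is the polarised
    rho_(k+1) (a_0, ..., a_k), because t_0 occurs there with exponent one.  On
    the right t_1 ... t_k is split into two squarefree monomials, of degrees
    k - j and j since e_(k-j) is homogeneous ([dhomog_rho]).  The coefficient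
    of the first one in e_(k-j) is a polarised rho_(k-j) of the corresponding
    a_i ([mcoeff_rho_polar]).  The coefficient of the second one in
    tr (a_0 B^j) is the polarised trace of a_0 and of the corresponding a_i
    ([mcoeff_tr_polar]).  Therefore
      rho (a_0, ..., a_k) =
        \sum_S (-1)^|S| rho (a_i, i \notin S) tr (a_0, a_S)
    over the subsets S of {1, ..., k}.

    Let k + 1 <= r.  Each factor tr (a_0, a_S) has at most k + 1 arguments, so
    the left-hand side vanishes as soon as all the polarised traces do.
    Conversely, every factor rho (a_i, i \notin S) has between 1 and k
    arguments, except that it is 1 for S = {1, ..., k}; so if the polarised
    rho vanish, the identity reduces to 0 = (-1)^k tr (a_0, ..., a_k). *)

(** * Derivations and the characteristic polynomial *)

Definition leibniz (R : nzRingType) (D : R -> R) : Prop :=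
  forall x y : R, D (x * y) = D x * y + x * D y.

Lemma leibniz1 (R : nzRingType) (D : {additive R -> R}) :
  leibniz D -> D 1 = 0.
Proof.
move=> DM; apply: (addrI (D 1)); rewrite addr0.
by have := DM 1 1; rewrite !mulr1 mul1r => <-.
Qed.

Lemma leibniz_prod (R : comNzRingType) (D : {additive R -> R}) n
    (f : 'I_n -> R) : leibniz D ->
  D (\prod_i f i) = \sum_i D (f i) * \prod_(j | j != i) f j.
Proof.
move=> DM; elim: n f => [|n IH] f; first by rewrite !big_ord0 leibniz1.
rewrite !big_ord_recl DM IH; congr (_ * _ + _).
  by rewrite [RHS]big_mkcond big_ord_recl /= mul1r; apply: eq_bigr.
rewrite big_distrr /=; apply: eq_bigr => i _.
rewrite mulrCA; congr (_ * _).
rewrite [RHS]big_mkcond big_ord_recl /= big_mkcond; congr (_ * _).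
Qed.

(** Jacobi's formula.  The derivative of the Leibniz expansion is the sum over i
    of the determinants in which row i alone is differentiated; expanding each
    along its row i produces the cofactors of M. *)
Lemma leibniz_det (R : comNzRingType) (D : {additive R -> R}) n (M : 'M[R]_n) :
  leibniz D -> D (\det M) = \tr (\adj M *m map_mx D M).
Proof.
move=> DM.
have signE (b : bool) x : D ((-1) ^+ b * x) = (-1) ^+ b * D x.
  by case: b; rewrite ?mul1r // !mulN1r raddfN.
transitivity (\sum_i
    \det (\matrix_(k, j) (if k == i then D (M k j) else M k j))).
  rewrite /determinant raddf_sum exchange_big /=; apply: eq_bigr => s _.
  rewrite signE leibniz_prod // -mulr_sumr; congr (_ * _).
  apply: eq_bigr => i _; rewrite [RHS](bigD1 i) //= mxE eqxx; congr (_ * _).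
  by apply: eq_bigr => j /negPf ji; rewrite mxE ji.
rewrite /mxtrace.
under [RHS]eq_bigr => j _ do rewrite mxE.
rewrite [RHS]exchange_big /=; apply: eq_bigr => i _.
rewrite (expand_det_row _ i); apply: eq_bigr => j _.
rewrite !mxE eqxx mulrC; congr (_ * _).
rewrite /cofactor; congr (_ * \det _).
by apply/matrixP=> k l; rewrite !mxE eq_sym (negPf (neq_lift _ _)).
Qed.

Lemma leibniz_map_poly (R : nzRingType) (D : {additive R -> R}) :
  leibniz D -> leibniz (map_poly D).
Proof.
move=> DM p q; apply/polyP=> i.
rewrite coefD coef_map !coefM raddf_sum -big_split /=.
by apply: eq_bigr => j _; rewrite DM !coef_map.
Qed.

(** Comparing coefficients in (X - B) adj (X - B) = det (X - B) gives
    N_i = c_(i+1) + B N_(i+1) for the matrix N_i of the coefficients of X^i in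
    the adjugate; this recursion is solved downwards from N_n = 0. *)
Lemma coef_adj_char_poly_mx (R : comNzRingType) n (B : 'M[R]_n) j :
  (j < n)%N ->
  map_mx (coefp (n - j.+1)) (\adj (char_poly_mx B)) =
    \sum_(l < j.+1) (char_poly B)`_(n - l) *: B ^+ (j - l).
Proof.
set N := fun i => map_mx (coefp i) (\adj (char_poly_mx B)).
have step i : N i = ((char_poly B)`_i.+1)%:M + B *m N i.+1.
  apply/matrixP=> u v.
  have := congr1 (fun M : 'M[{poly R}]_n => (M u v)`_i.+1)
    (mul_mx_adj (char_poly_mx B)).
  rewrite {1}/char_poly_mx mulmxBl mul_scalar_mx !mxE coefB coefXM /=.
  rewrite /char_poly coefMn -mulr_natr => E.
  apply/eqP; rewrite -subr_eq; apply/eqP.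
  rewrite -E coef_sum; congr (_ - _).
  by apply: eq_bigr => w _; rewrite !mxE coefCM.
have top i : (n <= i)%N -> N i = 0.
  move=> ni.
  (* c_i vanishes beyond n, so that N_i = B^m N_(i+m) for every m, and the
     right-hand side is zero once i + m exceeds the degree of the adjugate. *)
  have down m : N i = B ^+ m *m N (i + m)%N.
    elim: m => [|m IH]; first by rewrite addn0 expr0 mul1mx.
    rewrite IH step nth_default ?size_char_poly; last first.
      by rewrite ltnS (leq_trans ni) ?leq_addr.
    by rewrite raddf0 add0r mulmxA mulmxE -exprSr addnS.
  pose m := (\max_u \max_v size (\adj (char_poly_mx B) u v))%N.
  rewrite (down m) (_ : N (i + m)%N = 0) ?mulmx0 //.
  apply/matrixP=> u v; rewrite [LHS]mxE [RHS]mxE /= nth_default //.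
  rewrite (leq_trans _ (leq_addl _ _)) // /m.
  apply: leq_trans (leq_bigmax u).
  exact: leq_bigmax.
elim: j => [|j IH] jn.
  rewrite big_ord1 subn0 expr0 -/(N _) step.
  have -> : (n - 1).+1 = n by rewrite subn1 prednK.
  by rewrite top // mulmx0 addr0 scalemx1.
rewrite -/(N _) step -subSn // subSS /N IH; last exact: ltnW.
rewrite [RHS]big_ord_recr /= subnn expr0 addrC scalemx1 mulmx_sumr.
congr (_ + _).
apply: eq_bigr => l _; rewrite -scalemxAr mulmxE -exprS subSn //.
by rewrite -ltnS.
Qed.

(** The derivative of Newton's identity, valid in every characteristic: D is
    extended coefficientwise to a derivation of R[X] that kills X, and Jacobi's
    formula is applied to X - B. *)
Lemma leibniz_rho (R : comNzRingType) (D : {additive R -> R}) n (B : 'M[R]_n)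
    k : leibniz D -> (k < n)%N ->
  D (rho k.+1 B) =
    \sum_(j < k.+1) (-1) ^+ j * rho (k - j) B * \tr (map_mx D B *m B ^+ j).
Proof.
move=> DM kn.
have signE (i : nat) x : D ((-1) ^+ i * x) = (-1) ^+ i * D x.
  by rewrite -signr_odd; case: odd; rewrite ?mul1r // !mulN1r raddfN.
rewrite /rho signE -[D _]coef_map /char_poly.
rewrite (leibniz_det _ (leibniz_map_poly DM)).
have -> : map_mx (map_poly D) (char_poly_mx B) = - map_mx polyC (map_mx D B).
  apply/matrixP=> i j; rewrite !mxE raddfB /= map_polyC /= raddfMn /=.
  suff -> : map_poly D 'X = 0 by rewrite mul0rn add0r.
  apply/polyP=> [[|[|m]]]; rewrite coef_map coefX coef0 /= ?raddf0 //.
  exact: leibniz1.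
rewrite mulmxN raddfN /= coefN.
have -> : (\tr (\adj (char_poly_mx B) *m map_mx polyC (map_mx D B)))`_(n - k.+1)
    = \tr (map_mx (coefp (n - k.+1)) (\adj (char_poly_mx B)) *m map_mx D B).
  rewrite /mxtrace coef_sum; apply: eq_bigr => i _.
  by rewrite !mxE coef_sum; apply: eq_bigr => j _; rewrite !mxE coefMC.
rewrite mulrN -mulNr exprS mulN1r opprK.
rewrite coef_adj_char_poly_mx // mxtrace_mulC mulmx_sumr raddf_sum mulr_sumr.
rewrite (reindex_inj rev_ord_inj); apply: eq_bigr => [[j /= jk] _].
rewrite ltnS in jk.
rewrite -scalemxAr mxtraceZ subSS subKn // !mulrA; congr (_ * _ * _).
by rewrite -exprD subnKC.
Qed.

Lemma rho0 (R : comNzRingType) n (B : 'M[R]_n) : rho 0 B = 1.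
Proof.
rewrite /rho mul1r subn0; have /monicP := char_poly_monic B.
by rewrite lead_coefE size_char_poly.
Qed.

(** * Homogeneity of the characteristic coefficients *)

Lemma generic_combE (K : fieldType) n k (a : 'I_k -> 'M[K]_n) u v :
  generic_comb a u v = \sum_i a i u v *: 'X_i.
Proof.
rewrite /generic_comb summxE; apply: eq_bigr => i _.
by rewrite !mxE mulrC mul_mpolyC.
Qed.

(** Homogeneity of total degree d when X is given degree 1 together with the
    t_i.  All entries of X - B have this property with d = 1. *)
Definition bihomog (R : comNzRingType) k d (p : {poly {mpoly R[k]}}) : Prop :=
  forall i,
    ((i <= d)%N -> p`_i \is (d - i)%N.-homog) /\ ((d < i)%N -> p`_i = 0).

Lemma bihomogM (R : comNzRingType) k d e (p q : {poly {mpoly R[k]}}) :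
  bihomog d p -> bihomog e q -> bihomog (d + e) (p * q).
Proof.
move=> hp hq i; rewrite coefM; split=> hi; last first.
  apply: big1 => j _.
  have [dj|jd] := ltnP d j; first by rewrite (hp j).2 ?mul0r.
  rewrite (hq (i - j)%N).2 ?mulr0 // ltn_subRL.
  by apply: leq_ltn_trans hi; rewrite leq_add2r.
apply: rpred_sum => [[j /= ji] _]; rewrite ltnS in ji.
have [dj|jd] := ltnP d j; first by rewrite (hp j).2 ?mul0r ?rpred0.
have [ej|je] := ltnP e (i - j); first by rewrite (hq _).2 ?mulr0 ?rpred0.
have -> : (d + e - i = (d - j) + (e - (i - j)))%N.
  rewrite -{1}(subnKC ji) subnDA addnBA // [(d - j + e)%N]addnC addnBA //.
  by rewrite addnC.
by apply: dhomogM; [apply: (hp j).1 | apply: (hq _).1].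
Qed.

(** Up to sign this is the coefficient of X^(n-i) in a sum of products of n
    entries of X - B, each of total degree 1. *)
Lemma dhomog_rho (K : fieldType) n k (a : 'I_k -> 'M[K]_n) i :
  (i <= n)%N -> rho i (generic_comb a) \is i.-homog.
Proof.
move=> i_n; rewrite /rho -signr_odd.
suff h : bihomog n (char_poly (generic_comb a)).
  have := (h (n - i)%N).1 (leq_subr _ _); rewrite subKn // => hi.
  by case: odd; rewrite ?mul1r // mulN1r rpredN.
have hB u v : generic_comb a u v \is 1.-homog.
  rewrite generic_combE; apply: rpred_sum => l _.
  by rewrite rpredZ // dhomogX /= mdeg1.
have hE u v : bihomog 1 (char_poly_mx (generic_comb a) u v).
  move=> j; rewrite !mxE coefB coefC coefMn coefX; case: j => [|[|j]] /=.
  - by split=> // _; rewrite mul0rn sub0r rpredN.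
  - by split=> // _; rewrite subr0; case: (u == v); rewrite ?rpred0 // dhomog1.
  - by split=> // _; rewrite mul0rn subr0.
have prodP m (f : 'I_m -> {poly {mpoly K[k]}}) :
    (forall l, bihomog 1 (f l)) -> bihomog m (\prod_l f l).
  elim: m f => [|m IH] f hf.
    rewrite big_ord0 => j; rewrite coef1; case: j => [|j] /=; split=> // _.
    exact: dhomog1.
  by rewrite big_ord_recl; apply: (bihomogM (d := 1) (e := m)); [|apply: IH].
move=> j; rewrite /char_poly /determinant coef_sum; split=> hj.
  apply: rpred_sum => s _; rewrite -polyC1 -polyCN -polyC_exp coefCM.
  by case: (s : bool); rewrite ?mul1r ?mulN1r ?rpredN; apply: (prodP _ _ _ j).1.
apply: big1 => s _; rewrite -polyC1 -polyCN -polyC_exp coefCM.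
by rewrite (prodP _ _ _ j).2 // mulr0.
Qed.

(** * Traces of powers of the generic combination *)

Lemma prod_monomial_mx (K : fieldType) n k j (w : 'I_j -> 'I_k)
    (b : 'I_j -> 'M[K]_n) :
  \prod_l ('X_(w l) *: map_mx (@mpolyC k K) (b l)) =
    'X_[\sum_l U_(w l)] *: map_mx (@mpolyC k K) (\prod_l b l).
Proof.
elim: j w b => [|j IH] w b.
  rewrite !big_ord0 mpolyX0 scale1r.
  by apply/matrixP=> u v; rewrite !mxE mpolyCMn.
rewrite !big_ord_recl IH -[LHS]/(_ *m _) -[b ord0 * _]/(_ *m _).
by rewrite -scalemxAl -scalemxAr scalerA mpolyXD map_mxM.
Qed.

Lemma generic_comb_exp (K : fieldType) n k (a : 'I_k -> 'M[K]_n) j :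
  generic_comb a ^+ j =
    \sum_(w : {ffun 'I_j -> 'I_k})
      'X_[\sum_l U_(w l)] *: map_mx (@mpolyC k K) (\prod_l a (w l)).
Proof.
have -> : generic_comb a ^+ j = \prod_(l < j) generic_comb a.
  by rewrite prodr_const card_ord.
rewrite bigA_distr_bigA; apply: eq_bigr => w _.
exact: prod_monomial_mx.
Qed.

Lemma mxtrace_generic_comb_exp (K : fieldType) n k (a : 'I_k -> 'M[K]_n) C j :
  \tr (map_mx (@mpolyC k K) C *m generic_comb a ^+ j) =
    \sum_(w : {ffun 'I_j -> 'I_k})
      \tr (C *m \prod_l a (w l)) *: 'X_[\sum_l U_(w l)].
Proof.
rewrite generic_comb_exp mulmx_sumr raddf_sum; apply: eq_bigr => w _.
by rewrite -scalemxAr /= mxtraceZ -map_mxM trace_map_mx mulrC mul_mpolyC.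
Qed.

(** The exponent of t_i in the monomial of a word is the number of occurrences
    of the letter i, so the monomial determines the word up to reordering. *)
Lemma mnm_sumU_perm k j (g w : 'I_j -> 'I_k) :
  (\sum_l U_(w l) = \sum_l U_(g l))%MM ->
  exists s : 'S_j, forall l, w l = g (s l).
Proof.
move=> E.
have /tuple_permP[s hs] : perm_eq [tuple w l | l < j] [tuple g l | l < j].
  apply/allP=> i _ /=; apply/eqP.
  have /(congr1 (fun m : 'X_{1..k} => m i)) := E.
  have cnt (f : 'I_j -> 'I_k) :
      (\sum_l U_(f l))%MM i = count_mem i [tuple f l | l < j].
    rewrite mnm_sumE -sum1_count big_map [RHS]big_mkcond /= enumT.
    by apply: eq_bigr => l _; rewrite mnm1E; case: eqP.
  by rewrite !cnt.
exists s => l.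
have := congr1 (fun t => nth (w l) t l) hs.
by rewrite -!tnth_nth !tnth_mktuple.
Qed.

Lemma perm_on_gt0 j (s : 'S_j.+1) :
  perm_on [set i : 'I_j.+1 | (0 < i)%N] s = (s ord0 == ord0).
Proof.
apply/idP/eqP => [hs|s0]; first by apply: (out_perm hs); rewrite inE.
apply/subsetP=> i; rewrite !inE lt0n; apply: contra => /eqP i0.
by rewrite (_ : i = ord0) ?s0 //; apply: val_inj.
Qed.

(** The words w in the expansion of B^j that contribute to this coefficient are
    the rearrangements of l |-> h (lift ord0 l), all distinct since h is
    injective; they correspond to the permutations of 'I_j.+1 fixing 0. *)
Lemma mcoeff_tr_polar (K : fieldType) n k j (a : 'I_k -> 'M[K]_n)
    (h : 'I_j.+1 -> 'I_k) : injective h ->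
  (\tr (map_mx (@mpolyC k K) (a (h ord0)) *m generic_comb a ^+ j))
      @_(\sum_(l < j) U_(h (lift ord0 l))) =
    tr_polar (a \o h).
Proof.
move=> h_inj; rewrite mxtrace_generic_comb_exp raddf_sum /=.
pose m := (\sum_(l < j) U_(h (lift ord0 l)))%MM.
pose P (s : 'S_j.+1) := [ffun l => h (s (lift ord0 l))].
rewrite (eq_bigr (fun w : {ffun _ -> _} =>
    if (\sum_l U_(w l) == m)%MM then \tr (a (h ord0) *m \prod_l a (w l))
    else 0));
  last first.
  by move=> w _; rewrite mcoeffZ mcoeffX; case: eqP; rewrite ?mulr1 ?mulr0.
rewrite -big_mkcond /=.
have -> : \sum_(w : {ffun 'I_j -> 'I_k} | (\sum_l U_(w l) == m)%MM)
      \tr (a (h ord0) *m \prod_l a (w l))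
    = \sum_(w in P @: [set s : 'S_j.+1 | s ord0 == ord0])
      \tr (a (h ord0) *m \prod_l a (w l)).
  apply: eq_bigl => w; apply/eqP/imsetP => [/mnm_sumU_perm[s hs]|[s]].
    exists (lift_perm ord0 ord0 s); first by rewrite inE lift_perm_id.
    by apply/ffunP=> l; rewrite ffunE lift_perm_lift hs.
  rewrite inE => /eqP s0 ->; rewrite /m.
  pose f i := U_(h i)%MM : 'X_{1..k}.
  (* Permuting by s does not change the sum over 'I_j.+1, and the term of
     index 0, which s fixes, cancels on both sides. *)
  have := erefl (\sum_i f i)%MM; rewrite {1}(reindex_inj (@perm_inj _ s)) /=.
  rewrite !big_ord_recl s0 => /addmI E.
  by rewrite -[RHS]E; apply: eq_bigr => l _; rewrite ffunE.
rewrite big_imset /=; last first.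
  move=> s t; rewrite !inE => /eqP s0 /eqP t0 /ffunP E.
  apply/permP=> i; case: (unliftP ord0 i) => [l|] ->; last by rewrite s0 t0.
  by apply: h_inj; have := E l; rewrite !ffunE.
rewrite /tr_polar; apply: eq_big => [s|s]; first by rewrite inE perm_on_gt0.
rewrite inE => /eqP s0; rewrite big_ord_recl -[X in _ = \tr X]/(_ *m _) /= s0.
by congr (\tr (_ *m _)); apply: eq_bigr => l _; rewrite ffunE.
Qed.

(** * Reduction to fewer variables *)

(** The substitution t_(h l) |-> t_l, with the other variables sent to 0, maps
    the generic combination of a to that of a \o h.  It annihilates the
    monomials that involve a variable outside the image of h and is injective
    on the others. *)
Lemma mcoeff_rho_polar (K : fieldType) n k d (a : 'I_k -> 'M[K]_n)
    (h : 'I_d -> 'I_k) : injective h ->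
  (rho d (generic_comb a))@_(\sum_l U_(h l)) = rho_polar (a \o h).
Proof.
move=> h_inj.
pose v (i : 'I_k) : {mpoly K[d]} := \sum_(l < d | h l == i) 'X_l.
have vh l : v (h l) = 'X_l.
  rewrite /v (bigD1 l) //= big1 ?addr0 // => l' /andP[/eqP/h_inj->].
  by rewrite eqxx.
have v0 i : i \notin codom h -> v i = 0.
  by move=> hi; apply: big1 => l /eqP E; case/negP: hi; rewrite -E codom_f.
pose phi : {rmorphism {mpoly K[k]} -> {mpoly K[d]}} := mmap (@mpolyC d K) v.
have phi_comb : map_mx phi (generic_comb a) = generic_comb (a \o h).
  apply/matrixP=> x y; rewrite mxE !generic_combE raddf_sum /=.
  under eq_bigr => i _ do rewrite mmapZ mmapX mmap1U mulr_sumr.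
  rewrite (exchange_big_dep predT) //=; apply: eq_bigr => l _.
  by rewrite (big_pred1 (h l)) ?mul_mpolyC // => i; rewrite eq_sym.
rewrite /rho_polar -phi_comb.
have -> : rho d (map_mx phi (generic_comb a)) = phi (rho d (generic_comb a)).
  by rewrite /rho -map_char_poly coef_map rmorphM rmorph_sign.
set p := rho _ _.
rewrite [X in X@__ = _]mpolyE.
have -> : phi p = \sum_(m <- msupp p) (p@_m)%:MP * mmap1 v m by [].
rewrite !raddf_sum.
apply: eq_bigr => m _ /=.
rewrite mcoeffZ mcoeffX mul_mpolyC mcoeffZ; congr (_ * _).
have Uh l : (\sum_l' U_(h l'))%MM (h l) = 1%N.
  rewrite mnm_sumE (bigD1 l) //= mnm1E eqxx big1 // => l' /negPf ne.
  by rewrite mnm1E (inj_eq h_inj) ne.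
have U0 i : i \notin codom h -> (\sum_l U_(h l))%MM i = 0%N.
  move=> hi; rewrite mnm_sumE big1 // => l _; rewrite mnm1E.
  by case: eqP hi => // <-; rewrite codom_f.
have [/forallP hm|] := boolP [forall i, (m i != 0%N) ==> (i \in codom h)];
  last first.
  rewrite negb_forall => /existsP[i]; rewrite negb_imply => /andP[mi hi].
  rewrite /mmap1 (bigD1 i) //= v0 // expr0n (negPf mi) mul0r mcoeff0.
  by case: eqP => // E; rewrite E U0 in mi.
have m0 i : i \notin codom h -> m i = 0%N.
  by apply: contraNeq => mi; apply: (implyP (hm i)).
have -> : mmap1 v m = 'X_[[multinom m (h l) | l < d]].
  rewrite mpolyXE_id /mmap1.
  transitivity (\prod_(i in h @: 'I_d) v i ^+ m i).
    rewrite [RHS]big_mkcond; apply: eq_bigr => i _; case: ifP => // /negP hi.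
    rewrite m0 ?expr0 //; apply/negP=> /codomP[l E].
    by apply: hi; rewrite E imset_f.
  rewrite big_imset /=; last exact: in2W.
  by apply: eq_bigr => l _; rewrite vh mnmE.
rewrite mcoeffX; congr (_%:R); congr nat_of_bool.
apply/eqP/eqP => [E|/mnmP E]; apply/mnmP => i.
  by rewrite !mnmE E Uh.
have [/codomP[l ->]|hi] := boolP (i \in codom h).
  by have := E l; rewrite !mnmE Uh.
by rewrite m0 // U0.
Qed.

Lemma mdeg_sumU k d (w : 'I_d -> 'I_k) : mdeg (\sum_l U_(w l)) = d.
Proof.
rewrite mdeg_sum; under eq_bigr => l _ do rewrite mdeg1.
by rewrite sum1_card card_ord.
Qed.

Lemma squarefree_mnm_enum k (m : 'X_{1..k}) : (forall i, m i <= 1)%N ->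
  exists d (h : 'I_d -> 'I_k), injective h /\ m = (\sum_l U_(h l))%MM.
Proof.
move=> hm; pose A := [set i | m i != 0%N].
exists #|A|, (fun l => enum_val l); split; first exact: enum_val_inj.
apply/mnmP=> i; rewrite mnm_sumE.
rewrite -(big_enum_val (fun x => U_(x)%MM i)) /=.
transitivity (\sum_(x in A) (x == i))%N; last first.
  by apply: eq_bigr => x _; rewrite mnm1E.
have := hm i; case E: (m i) => [|[|//]] _.
  rewrite big1 // => x; rewrite inE => mx.
  by case: (x =P i) => // xi; rewrite xi E in mx.
rewrite (bigD1 i) ?inE ?E //= eqxx big1 // => x /andP[_ /negPf->] //.
Qed.

(** * The recursion between polarised coefficients and polarised traces *)

(** The exponent of t_1 ... t_k in the k + 1 variables t_0, ..., t_k. *)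
Definition tail_mnm k : 'X_{1..k.+1} := (\sum_(l < k) U_(lift ord0 l))%MM.

Lemma tail_mnmE k i : tail_mnm k i = (i != ord0).
Proof.
rewrite mnm_sumE; case: (unliftP ord0 i) => [l|] ->; last first.
  by rewrite big1 // => l _; rewrite mnm1E eq_sym (negPf (neq_lift _ _)).
rewrite (bigD1 l) //= mnm1E eqxx big1 // => l' /negPf ne.
by rewrite mnm1E (inj_eq lift_inj) ne.
Qed.

(** Since t_0 has exponent 1 in t_0 ... t_k, extracting the coefficient of
    t_0 ... t_k is differentiating in t_0 and then extracting the coefficient
    of t_1 ... t_k. *)
Lemma rho_polar_rec (K : fieldType) n k (a : 'I_k.+1 -> 'M[K]_n) : (k < n)%N ->
  rho_polar a =
    \sum_(j < k.+1) (-1) ^+ j *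
      (rho (k - j) (generic_comb a) *
       \tr (map_mx (@mpolyC _ K) (a ord0) *m generic_comb a ^+ j))
         @_(tail_mnm k).
Proof.
move=> kn; rewrite /rho_polar.
have -> : [multinom 1%N | i < k.+1] = (tail_mnm k + U_(ord0))%MM.
  apply/mnmP=> i; rewrite mnmDE mnmE tail_mnmE mnm1E eq_sym.
  by case: eqP.
have DM : leibniz (mderiv (R := K) (@ord0 k)) by move=> p q; exact: mderivM.
have -> p : p@_(tail_mnm k + U_(ord0)) = (mderiv ord0 p)@_(tail_mnm k) :> K.
  by rewrite mcoeff_deriv tail_mnmE.
rewrite (leibniz_rho _ DM kn) raddf_sum; apply: eq_bigr => j _.
have -> : map_mx (mderiv ord0) (generic_comb a) = map_mx (@mpolyC _ K) (a ord0).
  apply/matrixP=> u v; rewrite !mxE generic_combE raddf_sum (bigD1 ord0) //=.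
  rewrite mderivZ mderivX mnm1E eqxx scale1r.
  rewrite (_ : (U_(_) - _)%MM = 0%MM); last first.
    by apply/mnmP=> i; rewrite mnmBE mnm0E subnn.
  rewrite mpolyX0 alg_mpolyC.
  rewrite big1 ?addr0 // => i /negPf i0.
  by rewrite mderivZ mderivX mnm1E i0 scale0r scaler0.
rewrite /= -mulrA -signr_odd -[in RHS]signr_odd.
case: odd; last by rewrite !mul1r.
by rewrite !mulN1r mcoeffN.
Qed.

(** The coefficient is zero for lack of homogeneity unless m has degree d; then
    h enumerates the support of m. *)
Lemma mcoeff_rho_squarefree (K : fieldType) n k (a : 'I_k -> 'M[K]_n) d
    (m : 'X_{1..k}) :
  (d <= n)%N -> (forall i, m i <= 1)%N ->
  (rho d (generic_comb a))@_m = 0 \/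
  exists h : 'I_d -> 'I_k, (rho d (generic_comb a))@_m = rho_polar (a \o h).
Proof.
move=> dn /squarefree_mnm_enum[e [h [h_inj mE]]].
have [me|ne] := eqVneq (mdeg m) d; last first.
  by left; apply: dhomog_nemf_coeff ne; apply: dhomog_rho.
have {me} ed : e = d by rewrite -me mE mdeg_sumU.
by case: d / ed dn => _; right; exists h; rewrite mE mcoeff_rho_polar.
Qed.

(** The condition on m keeps t_0 out of the monomial, so that adding a_0 to the
    matrices selected by m repeats none of them. *)
Lemma mcoeff_tr_squarefree (K : fieldType) n k (a : 'I_k.+1 -> 'M[K]_n) j
    (m : 'X_{1..k.+1}) :
  (forall i, m i <= 1)%N -> m ord0 = 0%N ->
  let t := \tr (map_mx (@mpolyC _ K) (a ord0) *m generic_comb a ^+ j) in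
  t@_m = 0 \/ exists h : 'I_j.+1 -> 'I_k.+1, t@_m = tr_polar (a \o h).
Proof.
move=> /squarefree_mnm_enum[e [h [h_inj mE]]] m0 t.
have [ej|ne] := eqVneq e j; last first.
  left; rewrite /t mxtrace_generic_comb_exp raddf_sum big1 //= => w _.
  rewrite mcoeffZ mcoeffX; case: eqP => [E|]; rewrite ?mulr0 //.
  by case/eqP: ne; rewrite -(mdeg_sumU h) -(mdeg_sumU w) E mE.
case: j / ej @t => t; right.
pose g i := if unlift ord0 i is Some l then h l else ord0.
have gl l : g (lift ord0 l) = h l by rewrite /g liftK.
have g0 : g ord0 = ord0 by rewrite /g unlift_none.
have h0 l : h l != ord0.
  apply: contra_eq_neq m0 => hl; rewrite mE mnm_sumE (bigD1 l) //= mnm1E hl.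
  by rewrite eqxx.
exists g; rewrite -mcoeff_tr_polar ?g0; last first.
  move=> x y.
  case: (unliftP ord0 x) => [u|] ->; case: (unliftP ord0 y) => [v|] ->;
    rewrite ?gl ?g0 //.
  - by move/h_inj->.
  - by move=> E; have := h0 u; rewrite E eqxx.
  - by move=> E; have := h0 v; rewrite -E eqxx.
by rewrite /t mE; congr (_@_ _); apply: eq_bigr => l _; rewrite gl.
Qed.

Theorem theorem36 (F K : fieldType) (iota : {rmorphism F -> K}) (n : nat)
    (A : 'M[K]_n -> Prop) (hA : F_subalgebra iota A)
    (hrho : rho_F_valued iota A)
    (V : 'M[K]_n -> Prop) (hV : F_subspace iota V)
    (hVA : forall a : 'M[K]_n, V a -> A a)
    (r : nat) (hr : (r <= n)%N) :
  (forall k : nat, (1 <= k <= r)%N ->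
     forall a : 'I_k -> 'M[K]_n, (forall i, V (a i)) -> rho_polar a = 0)
  <->
  (forall k : nat, (1 <= k <= r)%N ->
     forall a : 'I_k -> 'M[K]_n, (forall i, V (a i)) -> tr_polar a = 0).
Proof.
have split_le k (m1 m2 : 'X_{1..k.+1}) : tail_mnm k = (m1 + m2)%MM ->
    [/\ forall i, (m1 i <= 1)%N, forall i, (m2 i <= 1)%N & m2 ord0 = 0%N].
  move/mnmP=> E.
  have le1 i : (m1 i + m2 i <= 1)%N by rewrite -mnmDE -E tail_mnmE leq_b1.
  split=> [i|i|].
  - exact: leq_trans (leq_addr _ _) (le1 i).
  - exact: leq_trans (leq_addl _ _) (le1 i).
  - have /esym/eqP := E ord0.
    by rewrite mnmDE tail_mnmE eqxx addn_eq0 => /andP[_ /eqP].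
split=> H [//|k] /andP[_ kr] a Va; have kn := leq_trans kr hr.
(* All terms of the recursion with j < k contain a shorter polarised rho, and
   the one with j = k is the polarised trace of a up to sign. *)
- have := rho_polar_rec a kn.
  rewrite H // big_ord_recr big1 /= => [|j _].
    rewrite add0r subnn rho0 mul1r (mcoeff_tr_polar a (@inj_id _)) //.
    rewrite -signr_odd; case: odd; rewrite ?mul1r // mulN1r => /esym/eqP.
    by rewrite oppr_eq0 => /eqP.
  rewrite mcoeffM big1 ?mulr0 // => m /eqP /split_le[m1 _ _].
  have [|->|[h ->]] := mcoeff_rho_squarefree a (d := k - j) _ m1.
  + by rewrite (leq_trans (leq_subr _ _)) // ltnW.
  + by rewrite mul0r.
  + rewrite H ?mul0r // => [|i]; last exact: Va.
    by rewrite subn_gt0 ltn_ord (leq_trans (leq_subr _ _)) // ltnW.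
(* Every term contains a polarised trace of j + 1 <= k + 1 matrices. *)
- rewrite rho_polar_rec // big1 // => j _.
  rewrite mcoeffM big1 ?mulr0 // => m /eqP /split_le[_ m2 m20].
  have [->|[h ->]] := mcoeff_tr_squarefree a j m2 m20; first by rewrite mulr0.
  rewrite H ?mulr0 // => [|i]; last exact: Va.
  by rewrite (leq_trans (ltn_ord j)).
Qed.
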